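(* There is an absolute constant $C>0$ such that for every integer $k\ge 3$ there is a finite graph $F_k$ with $e(F_k)\le e^{Ck}$ edges such that, for every $k$-edge-colouring of $F_k$ (an arbitrary assignment of one of $k$ colours to each edge), there exist an odd integer $h$ with $5\le h\le 4\lceil\log_2 k\rceil$ and a cycle of length $h$ in $F_k$ which is monochromatic (all its edges have the same colour) and is an induced subgraph of $F_k$.
   Context: All graphs are simple and undirected. $e(G)$ denotes the number of edges of $G$. A cycle in $G$ is induced if $G$ has no edge joining two vertices of the cycle other than the edges of the cycle itself. *)

(* Defs.v *)
From mathcomp Require Import all_boot.

Set Implicit Arguments.
Unset Strict Implicit.
Unset Printing Implicit Defensive.

Record sgraph := SGraph {
  vertex :> finType;
  adj : rel vertex;
  adj_sym : symmetric adj;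
  adj_irr : irreflexive adj }.

Definition edges (G : sgraph) : {set {set G}} :=
  [set [set x; y] | x in G, y in G & adj x y].

(* Cyclic sequence of pairwise distinct vertices, consecutive ones adjacent.
   The length (number of vertices = number of edges) is [size p]; the bound
   excludes the degenerate sequences accepted by [ucycleb]. *)
Definition is_cycle (G : sgraph) (p : seq G) : bool :=
  (3 <= size p)%N && ucycleb (@adj G) p.

Definition cycle_edges (G : sgraph) (p : seq G) : {set {set G}} :=
  [set [set x; next p x] | x in p].

Definition induced_cycle (G : sgraph) (p : seq G) : Prop :=
  forall x y : G, x \in p -> y \in p -> adj x y ->
    [set x; y] \in cycle_edges p.

(* Only the values of [c] on [edges G] matter: for [p] a cycle,
   [cycle_edges p] is a subset of [edges G]. *)
Definition monochromatic (G : sgraph) (k : nat) (c : {set G} -> 'I_k)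
    (p : seq G) : Prop :=
  exists i : 'I_k, forall f : {set G}, f \in cycle_edges p -> c f = i.

(* Main.v *)
Require Import Defs.
From HB Require Import structures.
From mathcomp Require Import all_boot all_order all_algebra.
From mathcomp Require Import all_classical all_reals all_analysis.
From mathcomp Require Import all_field zify ring lra.
(* Names shared with the classical sets refer to finite sets from here on. *)
From mathcomp Require Import fintype finset.

(** The host graph lives on the affine plane over a field with q elements, with
    (a, b) adjacent to (c, d) when b + d = a c.  It has no 4-cycle and its edges
    are distributed like those of a random graph of density 1/q
    ([host_mixing]).  Here q is K ^ 12 with K = 256 ^ k.

    Suppose that some colouring has no short monochromatic induced odd cycle.
    Every vertex carries a list of the colours that may still occur on its edges,
    and weight 256 to the number of colours that it has lost, so that the total
    weight W is q ^ 2 at the start.  As the edges are well distributed, some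
    colour i takes a fraction 1/k of the weighted edges, and around some vertex v
    breadth-first search in colour i soon reaches a set of weight of order W / k.
    Growth by a factor above 128 in each of the next 2 l - 3 steps, where l is the
    rounded up binary logarithm of k, would exceed W ([slow_growth]); hence there
    is a ball whose weight is at least 1/128 of that of the next ball.  If the
    layers of the ball span no edge of colour i, one deletes the next ball except
    for the layers of the heavier parity in the smaller one.  The surviving layers
    have essentially no edge of colour i any more, so this colour is struck from
    their lists, and the factor 256 gained in weight makes up for the deleted
    vertices.  Up to negligible errors W never drops, while each step shortens the
    lists of a substantial set of vertices ([descent_step]); this cannot go on
    ([descent_absurd]).

    It remains to see why an edge of colour i inside a layer yields an induced odd
    cycle ([layer_edge_closes]).  Breadth-first search is made robust: a vertex
    enters a layer only if it has at least D = 12 l neighbours of colour i in the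
    preceding one.  The edges that this rule neglects are few compared with all
    edges, and they are simply no longer trusted (the bad pairs below).  From the
    two ends of the edge one walks back towards v, choosing the predecessors one
    at a time.  Since there are no 4-cycles, each vertex chosen so far excludes at
    most three candidates, so D candidates always leave one that creates no
    chord.  Both walks have the same length, hence the cycle is odd.  The layers
    start at distance three from v, so its length is at least seven. *)

Set Implicit Arguments.
Unset Strict Implicit.
Unset Printing Implicit Defensive.

Import Order.TTheory GRing.Theory Num.Theory.
Local Open Scope ring_scope.

(** * Induced paths grown backwards through layers *)

Section Covering.
Local Open Scope nat_scope.

Lemma card_le_cover (I : eqType) (T : finType) (P : seq I) (B : I -> {set T}) (A : {set T}) n :
    (forall z, z \in P -> #|B z| <= n) ->
    (forall c, c \in A -> exists2 z, z \in P & c \in B z) ->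
  #|A| <= n * size P.
Proof.
elim: P A => [|z P ih] A cB cov.
  by rewrite muln0 leqn0 cards_eq0; apply/set0Pn => -[c /cov[]].
rewrite -(cardsID (B z) A) mulnS; apply: leq_add.
  by apply: leq_trans (subset_leq_card (subsetIr _ _)) (cB z _); rewrite mem_head.
apply: ih => [y yP|c]; first by apply: cB; rewrite inE yP orbT.
rewrite inE => /andP[cz /cov[y]]; rewrite inE => /orP[/eqP->|yP cy]; last by exists y.
by rewrite (negPf cz).
Qed.

End Covering.

Section InducedPaths.
Local Open Scope nat_scope.
Variables (V : finType) (adj H : rel V).
Hypotheses (adj_sym : symmetric adj) (adj_irr : irreflexive adj).
Hypothesis (C4free : forall x y c d, x != y ->
  adj x c -> adj y c -> adj x d -> adj y d -> c = d).
Hypotheses (H_sym : symmetric H) (H_adj : subrel H adj).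
Variable v : V.

(** Indexing makes the notion visibly invariant under reversal, so that a path
    can be extended at both of its ends through one lemma.  The root [v] only
    serves as the default value of [nth]. *)
Definition induced_path (p : seq V) := forall a b, a < b < size p ->
  if b == a.+1 then H (nth v p a) (nth v p b)
  else (nth v p a != nth v p b) && ~~ adj (nth v p a) (nth v p b).

Lemma induced_path_cons x p : induced_path p -> x \notin p ->
  H x (head v p) -> {in p, forall z, z != head v p -> ~~ adj x z} ->
  induced_path (x :: p).
Proof.
move=> ip xp Hx nadj [|a] [|b] //=; last first.
  by rewrite !ltnS eqSS; apply: ip.
rewrite ltnS; case: b => [|b] bp /=.
  by case: (p) Hx => [|y q].
rewrite (memPnC xp) ?mem_nth//=; apply: nadj; rewrite ?mem_nth//.
have p_gt0 : 0 < size p by apply: leq_ltn_trans bp.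
have := ip 0 b.+1 bp; rewrite nth0 /=.
case: eqP => [_ /H_adj|_ /andP[/eqP h _]]; last by apply/eqP => e; apply: h.
by move=> h; apply/eqP => e; rewrite e adj_irr in h.
Qed.

Lemma induced_path_uniq p : induced_path p -> uniq p.
Proof.
move=> ip; apply/(uniqP v) => a b; rewrite !inE => ap bp e.
wlog ab : a b ap bp e / a < b.
  by move=> h; case: (ltngtP a b) => // ab; [|apply: esym]; exact: h.
have := ip a b; rewrite ab bp e => /(_ isT); rewrite eqxx /=.
by case: ifP => // _ /H_adj; rewrite adj_irr.
Qed.

Lemma induced_path_rev p : induced_path p -> induced_path (rev p).
Proof.
move=> ip a b; rewrite size_rev => /andP[ab bp].
rewrite !nth_rev ?(ltn_trans ab)//.
have := ip (size p - b.+1) (size p - a.+1).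
have -> : (size p - a.+1 == (size p - b.+1).+1) = (b == a.+1) by lia.
have -> : size p - b.+1 < size p - a.+1 < size p by lia.
move=> /(_ isT); case: ifP => _; first by rewrite H_sym.
by rewrite adj_sym (eq_sym (nth v p (size p - b.+1))).
Qed.

(** A vertex [z] of [P] spoils at most three candidates: [z] itself, the common
    neighbour of [z] and [e], and the neighbour of [e] below the common
    neighbour of [z] and [v]; each of them is unique because there is no
    4-cycle.  The last property says that whichever parent between the new
    vertex and the root is used later, it creates no chord either. *)
Lemma avoiding_extension (P : seq V) e (A : {set V}) :
    v \notin P -> ~~ adj v e -> {in A, forall c, adj e c} ->
    3 * size P < #|A| ->
  exists2 c, c \in A & [/\ c \notin P,
    {in P, forall z, z != e -> ~~ adj c z} &
    forall w, adj v w -> adj w c -> {in P, forall z, ~~ adj w z}].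
Proof.
move=> vP ve eA cA.
pose B z := [set c in A | c == z] :|: [set c in A | (z != e) && adj c z]
  :|: [set c in A | [exists w, [&& adj v w, adj w c & adj w z]]].
have [/existsP[c /andP[cA' /allP/= cB]]|] :=
  boolP [exists c in A, all (fun z => c \notin B z) P].
  exists c => //.
  have {}cB z : z \in P -> [/\ c != z, (z != e) ==> ~~ adj c z &
      forall w, adj v w -> adj w c -> ~~ adj w z].
    move=> /cB; rewrite !inE cA'/= !negb_or negb_and negbK -!andbA.
    move=> /and3P[-> h /existsPn k]; split=> //.
      by rewrite implybE negbK.
    by move=> w vw wc; move: (k w); rewrite vw wc.
  split=> [|z zP ze|w vw wc z zP].
  - by apply/negP => /cB[]; rewrite eqxx.
  - by have [_ /implyP h _] := cB z zP; apply: h.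
  - by have [_ _] := cB z zP; apply.
move=> /existsPn h; move: cA; rewrite ltnNge => /negP[].
apply: (@card_le_cover _ _ P B) => [z zP|c cA]; last first.
  move: (h c); rewrite cA/= => /allPn[z zP]; rewrite negbK; by exists z.
have zv : v != z by apply: contraNneq vP => ->.
rewrite -[3]/(1 + 1 + 1); apply: leq_trans (leq_card_setU _ _).1 _; apply: leq_add.
  apply: leq_trans (leq_card_setU _ _).1 _; apply: leq_add.
  - by apply/card_le1_eqP => c d; rewrite !inE => /andP[_ /eqP->] /andP[_ /eqP->].
  - apply/card_le1_eqP => c d; rewrite !inE => /and3P[cA ze cz] /and3P[dA _ dz].
    by apply: (C4free ze); rewrite 1?(adj_sym z)// eA.
apply/card_le1_eqP => c d; rewrite !inE.
move=> /andP[cA /existsP[w /and3P[vw wc wz]]] /andP[dA /existsP[w' /and3P[vw' wd wz']]].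
have ww : w = w' by apply: (C4free zv) => //; rewrite adj_sym.
subst w'; have we : w != e by apply: contraNneq ve => <-.
by apply: (C4free we) => //; exact: eA.
Qed.

(** The walk back to the root relies on three properties of layers: [L_far]
    keeps chords away from the root, [L0_parent] leads the ends of the path to
    it, and [L_back] leaves more predecessors than can be spoilt. *)
Variables (L : nat -> {set V}) (D : nat).
Hypothesis L_far : forall s x, x \in L s -> (x != v) && ~~ adj v x.
Hypothesis L0_parent : forall x, x \in L 0 -> exists2 w, H v w & H w x.
Hypothesis L_back : forall s x, x \in L s.+1 -> D <= #|[set y in L s | H x y]|.

Lemma extend_back s p : induced_path p -> v \notin p -> head v p \in L s.+1 ->
    3 * size p < D ->
  exists2 x, x \in L s & [/\ induced_path (x :: p), v \notin x :: p &
    forall w, adj v w -> adj w x -> {in p, forall z, ~~ adj w z}].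
Proof.
move=> ip vp hL pD; have /andP[_ vh] := L_far hL.
have [||x] := @avoiding_extension p (head v p)
  [set y in L s | H (head v p) y] vp vh.
- by move=> c; rewrite inE => /andP[_ /H_adj].
- exact: leq_trans pD (L_back hL).
rewrite inE => /andP[xL Hx] [xp nadj par]; exists x => //; split=> //.
  by apply: induced_path_cons; rewrite // H_sym.
by rewrite inE negb_or vp eq_sym; have /andP[->] := L_far xL.
Qed.

(** [v :: q] is then an induced cycle of [H]. *)
Definition closes (q : seq V) := [/\ induced_path q, v \notin q,
  H v (head v q), H v (last v q) &
  {in q, forall z, adj v z -> z = head v q \/ z = last v q}].

Lemma head_rev (p : seq V) : head v (rev p) = last v p.
Proof. by case/lastP: p => // p x; rewrite rev_rcons last_rcons. Qed.

Lemma last_rev (p : seq V) : last v (rev p) = head v p.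
Proof. by rewrite -head_rev revK. Qed.

(** Both ends descend one layer at a time, alternately, until they lie in the
    seed [L 0]; there each of them has a parent adjacent to the root.  Handling
    the first parent before the second end reaches the seed lets
    [avoiding_extension] also keep the two parents apart. *)
Lemma close_path s p : induced_path p -> 0 < size p ->
    {in p, forall z, (z != v) && ~~ adj v z} ->
    head v p \in L s.+1 -> last v p \in L s.+1 ->
    3 * (size p + s.*2 + 3) < D ->
  exists2 q, closes q & size q = size p + s.*2 + 4.
Proof.
elim: s p => [|s ih] p ip p0 far hp lp pD.
  have vp : v \notin p by apply/negP => /far; rewrite eqxx.
  have [|x2 x2L [ip2 vp2 par2]] := extend_back ip vp hp; first by lia.
  have [x1 vx1 x12] := L0_parent x2L.
  have /andP[x2v nvx2] := L_far x2L.
  have x1p : x1 \notin x2 :: p.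
    rewrite inE negb_or; apply/andP; split.
      by apply: contraNneq nvx2 => <-; exact: H_adj.
    by apply/negP => /far; rewrite (H_adj vx1) andbF.
  have ip1 : induced_path (x1 :: x2 :: p).
    apply: induced_path_cons => // z; rewrite inE => /predU1P[->|zp _].
      by rewrite eqxx.
    exact: par2 (H_adj vx1) (H_adj x12) _ zp.
  have vx1' : v != x1.
    by apply/eqP => e; have := H_adj vx1; rewrite -e adj_irr.
  set q := rev (x1 :: x2 :: p).
  have vq : v \notin q by rewrite mem_rev inE negb_or vx1'.
  have lq : last v q = x1 by rewrite last_rev.
  have hq : head v q = last v p by rewrite head_rev /=; case: (p) p0.
  have memq z : (z \in q) = [|| z == x1, z == x2 | z \in p].
    by rewrite mem_rev !inE.
  have sq : size q = (size p).+2 by rewrite size_rev.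
  have iq : induced_path q by exact: induced_path_rev.
  clearbody q.
  have [||y2 y2L [ip3 vp3 par3]] := extend_back iq vq (s := 0).
  - by rewrite hq.
  - by rewrite sq; lia.
  have [y1 vy1 y12] := L0_parent y2L.
  have /andP[y2v nvy2] := L_far y2L.
  have y1q : {in q, forall z, ~~ adj y1 z} by apply: par3; exact: H_adj.
  have y1p : y1 \notin y2 :: q.
    rewrite inE negb_or; apply/andP; split.
      by apply: contraNneq nvy2 => <-; exact: H_adj.
    rewrite memq; apply/negP => /or3P[/eqP e|/eqP e|/far].
    - have /y1q : x2 \in q by rewrite memq eqxx orbT.
      by rewrite e (H_adj x12).
    - by rewrite e in vy1; rewrite (H_adj vy1) in nvx2.
    - by rewrite (H_adj vy1) andbF.
  have sz : size [:: y1, y2 & q] = size p + 0.*2 + 4.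
    by rewrite [size _]/= sq doubleE addn0 addn4.
  exists [:: y1, y2 & q]; last exact: sz.
  clear sz; have ly : last v [:: y1, y2 & q] = x1 by rewrite -lq; case: (q) sq.
  split; rewrite ?ly //.
  - apply: induced_path_cons => // z; rewrite inE => /predU1P[->|zp _].
      by rewrite eqxx.
    exact: y1q.
  - rewrite inE negb_or vp3 andbT.
    by apply/eqP => e; have := H_adj vy1; rewrite -e adj_irr.
  - move=> z; rewrite !inE memq => /or4P[/eqP->|/eqP->|/eqP->|]; [by left| | by right|].
      by rewrite (negPf nvy2).
    case/orP => [/eqP->|/far/andP[_ /negPf->]//].
    by rewrite (negPf nvx2).
have vp : v \notin p by apply/negP => /far; rewrite eqxx.
have [|x xL [ipx vpx _]] := extend_back ip vp hp; first by lia.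
have lx : head v (rev (x :: p)) = last v p by rewrite head_rev /=; case: (p) p0.
have [|||y yL [ipy vpy _]] := extend_back (induced_path_rev ipx) _ (s := s.+1).
- by rewrite mem_rev.
- by rewrite lx.
- by rewrite size_rev /=; lia.
have ly : last v (y :: rev (x :: p)) = head v (x :: p).
  by rewrite -last_rev rev_cons; case: (rev p).
have [|||||q cq sq] := ih (y :: rev (x :: p)) ipy; rewrite ?ly //.
- move=> z; rewrite inE mem_rev inE => /or3P[/eqP->|/eqP->|/far//].
    exact: L_far yL.
  exact: L_far xL.
- by rewrite /= size_rev /=; lia.
by exists q => //; rewrite sq /= size_rev /=; lia.
Qed.

Lemma layer_edge_closes t x y : x \in L t.+1 -> y \in L t.+1 -> H x y ->
  3 * (t.*2 + 5) < D -> exists2 q, closes q & size q = t.*2 + 6.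
Proof.
move=> xL yL xy tD.
have [|||||q cq sq] := @close_path t [:: x; y] _ isT.
- apply: induced_path_cons => //.
  + by move=> a b /= ab; exfalso; lia.
  + by rewrite inE; apply: contraTneq (H_adj xy) => ->; rewrite adj_irr.
  + by move=> z; rewrite inE /= => ->.
- by move=> z; rewrite !inE => /orP[]/eqP->; [exact: L_far xL|exact: L_far yL].
- exact: xL.
- exact: yL.
- by rewrite /=; lia.
by exists q => //; rewrite sq /=; lia.
Qed.

End InducedPaths.

(** * From closed induced paths to cycles *)

Section Closing.
Local Open Scope nat_scope.
Variables (G : sgraph) (k : nat) (c : {set G} -> 'I_k) (i : 'I_k) (H : rel G).
Hypothesis H_col : forall x y, H x y -> adj x y /\ c [set x; y] = i.
Hypothesis H_sym : symmetric H.

Lemma closed_induced_path v q : 2 <= size q -> closes (@adj G) H v q ->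
  [/\ is_cycle (v :: q), monochromatic c (v :: q) & induced_cycle (v :: q)].
Proof.
move=> sq [ip vq hq lq nadj].
have H_adj : subrel H (@adj G) by move=> x y /H_col[].
have uq : uniq (v :: q).
  by rewrite /= vq (induced_path_uniq (@adj_irr G) H_adj ip).
have cyc : cycle H (v :: q).
  rewrite /= rcons_path H_sym.
  rewrite lq andbT; case: (q) sq hq ip => [//|x r] _ /= -> ip /=.
  apply/(pathP v) => j jr; have := ip j j.+1; rewrite eqxx /= ltnSn ltnS jr.
  by apply.
split.
- by rewrite /is_cycle /= ltnS sq; rewrite /ucycleb uq andbT; apply: sub_cycle cyc.
- exists i => f /imsetP[x xp ->].
  by have [] := H_col (next_cycle cyc xp).
- move=> x y xp yp xy.
  have step a : a < size q -> [set nth v q a; nth v (v :: q) a] \in cycle_edges (v :: q).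
    move=> aq; apply/imsetP; exists (nth v (v :: q) a); first by rewrite mem_nth// /= ltnS ltnW.
    rewrite next_nth mem_nth ?index_uniq//= ?ltnS ?(ltnW aq)//.
    by rewrite setUC.
  have lst : [set v; last v q] \in cycle_edges (v :: q).
    have nv : next (v :: q) (last v q) = v.
      by rewrite next_nth mem_last index_last// nth_default.
    apply/imsetP; exists (last v q); first exact: mem_last.
    by rewrite nv setUC.
  wlog : x y xp yp xy / x = v \/ [/\ x \in q, y \in q & index x q < index y q].
    move=> h; move: (xp) (yp); rewrite !inE => /predU1P[xv|xq] /predU1P[yv|yq].
    - by apply: h => //; left.
    - by apply: h => //; left.
    - by rewrite setUC; apply: h; rewrite // 1?adj_sym//; left.
    case: (ltngtP (index x q) (index y q)) => [l|l|e].
    - by apply: h => //; right.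
    - by rewrite setUC; apply: h; rewrite // 1?adj_sym//; right.
    - by move: xy; rewrite -(nth_index v xq) e nth_index// adj_irr.
  case=> [xv|[xq yq xy_lt]].
    subst x; have {}yq : y \in q.
      by move: yp; rewrite inE => /predU1P[e|//]; rewrite e adj_irr in xy.
    case: (nadj y yq xy) => ->; last exact: lst.
    rewrite setUC; have := step 0; rewrite nth0 /=; apply.
    by apply: leq_trans sq.
  have := ip (index x q) (index y q).
  rewrite xy_lt index_mem yq !nth_index// => /(_ isT).
  case: eqP => [e _|_]; last by rewrite xy andbF.
  have := step (index y q); rewrite index_mem yq nth_index// e /= nth_index//.
  by rewrite setUC; apply.
Qed.
End Closing.

(** * Edge distribution and weighted degrees *)

Definition edge_sum (V : finType) (adj : rel V) (f g : V -> nat) : nat :=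
  \sum_x \sum_(y | adj x y) f x * g y.

(** A division-free expander mixing lemma for a graph of density 1/q: the edge
    sum of [f] and [g] is the product of their masses over [q], up to an error
    that the free parameter [l] balances between its two terms (the optimal
    choice would give the usual Cauchy-Schwarz bound).  The second inequality
    carries the diagonal sum for the sake of incidence relations whose loops have
    been removed. *)
Definition mixing (V : finType) (adj : rel V) (q : nat) :=
  forall (f g : V -> nat) (K l : nat), (forall x, g x <= K)%N ->
  let err := (K * (l ^ 2 * q ^ 2 + q ^ 3 * \sum_x f x ^ 2))%N in
  (l * q * edge_sum adj f g <= l * (\sum_x f x) * (\sum_x g x) + err)%N /\
  (l * (\sum_x f x) * (\sum_x g x) <=
     l * q * (edge_sum adj f g + \sum_x f x * g x) + err)%N.

Section WeightedGraphs.
Local Open Scope nat_scope.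
Variable V : finType.

Definition wdeg (H : rel V) (w : V -> nat) (X : {set V}) x :=
  \sum_(y in X | H x y) w y.

Lemma wdegD1 (H : rel V) w (X : {set V}) x z : x \in X ->
  wdeg H w X z = H z x * w x + wdeg H w (X :\ x) z.
Proof.
move=> xX; rewrite /wdeg big_mkcondr (big_setD1 x) //= -big_mkcondr.
by case: (H z x); rewrite ?mul1n.
Qed.

(** Deleting a vertex of low weighted degree destroys less weighted edge mass
    than its weight accounts for, so the density hypothesis is preserved and
    the deletion process stops before the set is exhausted. *)
Lemma dense_core (H : rel V) w (X : {set V}) t :
    symmetric H -> irreflexive H ->
    2 * t * (\sum_(x in X) w x) < \sum_(x in X) w x * wdeg H w X x ->
  exists Y : {set V}, [/\ Y \subset X, Y != set0 &
    {in Y, forall x, t <= wdeg H w Y x}].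
Proof.
move=> Hs Hi; elim: {X}_.+1 {-2}X (ltnSn #|X|) => // n ih X Xn dense.
have [/forall_inP h|] := boolP [forall x in X, t <= wdeg H w X x].
  exists X; split=> //; apply: contraTneq dense => ->.
  by rewrite !big_set0 muln0.
move=> /forall_inPn[x xX]; rewrite -ltnNge => lo.
have cX := cardsD1 x X; rewrite xX in cX.
have [||Y [YX Y0 Yt]] := ih (X :\ x); first by lia.
  move: dense; rewrite !(big_setD1 x xX) /=.
  have -> : \sum_(y in X :\ x) w y * wdeg H w X y =
      \sum_(y in X :\ x) w y * (H y x * w x) + \sum_(y in X :\ x) w y * wdeg H w (X :\ x) y.
    by rewrite -big_split; apply: eq_bigr => y _; rewrite (wdegD1 H w y xX) mulnDr.
  have -> : \sum_(y in X :\ x) w y * (H y x * w x) = w x * wdeg H w X x.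
    rewrite (wdegD1 _ _ _ xX) Hi mul0n add0n /wdeg big_mkcondr big_distrr /=.
    apply: eq_bigr => y _; rewrite Hs.
    by case: (H x y); rewrite ?mul1n ?mul0n ?muln0 // mulnC.
  move: (\sum_(_ in _) _) (\sum_(_ in _) _) => A B.
  have : w x * wdeg H w X x <= w x * t by rewrite leq_mul2l (ltnW lo) orbT.
  lia.
by exists Y; split=> //; apply: subset_trans YX (subsetDl _ _).
Qed.

(** Without 4-cycles the neighbourhoods of the neighbours of [v] are disjoint
    outside [v], so they add up.  The two units lost per neighbour [x] pay for
    [v] and for the only common neighbour of [v] and [x]. *)
Lemma second_neighbourhood (adj H : rel V) (X : {set V}) v d :
    symmetric adj -> irreflexive adj ->
    (forall x y a b, x != y -> adj x a -> adj y a -> adj x b -> adj y b -> a = b) ->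
    subrel H adj -> v \in X ->
    {in X, forall x, d + 2 <= #|[set y in X | H x y]|} ->
  d * d <= #|[set u in X | [&& u != v, ~~ adj v u & [exists x, H v x && H x u]]]|.
Proof.
move=> adj_sym adj_irr C4free Hadj vX deg.
set R := [set u in X | _]; pose A := [set y in X | H v y].
have xR x : x \in A -> d <= #|[set u in R | H x u]|.
  rewrite inE => /andP[xX vx].
  have vx' : v != x by apply: contraTneq (Hadj _ _ vx) => ->; rewrite adj_irr.
  rewrite -(leq_add2r 2); apply: leq_trans (deg x xX) _.
  apply: leq_trans (_ : #|[set u in R | H x u] :|:
      ([set v] :|: [set u | adj v u && adj x u])| <= _).
    apply/subset_leq_card/subsetP => u; rewrite !inE => /andP[uX xu].
    rewrite uX xu (Hadj _ _ xu) /= !andbT.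
    case: eqP => //= _; case: (adj v u) => //=; rewrite orbF.
    by apply/existsP; exists x; rewrite vx.
  apply: leq_trans (leq_card_setU _ _).1 _; rewrite leq_add2l.
  apply: leq_trans (leq_card_setU _ _).1 _; rewrite cards1 leq_add2l.
  apply/card_le1_eqP => a b; rewrite !inE => /andP[va xa] /andP[vb xb].
  exact: (C4free _ _ b a vx' vb xb va xa).
have cA : d <= #|A| by apply: leq_trans (deg v vX); exact: leq_addr.
apply: leq_trans (_ : #|A| * d <= _); first by rewrite leq_mul2r cA orbT.
apply: leq_trans (_ : \sum_(x in A) \sum_(u in R | H x u) 1 <= _).
  rewrite -sum_nat_const; apply: leq_sum => x /xR h.
  by rewrite sum1dep_card; apply: leq_trans h _; rewrite cardsE.
rewrite (exchange_big_dep (mem R)) /=; last by move=> x u _ /andP[].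
rewrite -sum1_card; apply: leq_sum => u uR.
rewrite sum1dep_card; apply/card_le1_eqP => a b; rewrite !inE.
move=> /andP[/andP[_ va] /andP[_ au]] /andP[/andP[_ vb] /andP[_ bu]].
have uv : v != u by move: uR; rewrite inE eq_sym => /and3P[].
by apply: (C4free _ _ b a uv); rewrite 1?(adj_sym u) ?Hadj.
Qed.

(** Every vertex of the seed [M] sees weight [t], hence so much edge mass leaves
    [M].  The part ending in vertices with fewer than [D] neighbours in [M] is
    small, and by mixing the remaining part forces its set [Q] of end vertices to
    be heavy, since a light set cannot absorb that many edges. *)
Lemma heavy_neighbourhood (adj H : rel V) w (U M Q : {set V}) q K t D lam :
    mixing adj q -> subrel H adj -> symmetric H -> (forall x, w x <= K) ->
    {in M, forall x, t <= wdeg H w U x} ->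
    Q = [set u in U | D <= #|[set y in M | H u y]|] ->
  lam * q * (#|M| * t) <= lam * q * (D * \sum_(u in U) w u)
    + (lam * #|M| * (\sum_(u in Q) w u) + K * (lam ^ 2 * q ^ 2 + q ^ 3 * #|M|)).
Proof.
move=> mix Hadj Hsym wK deg EQ.
pose f x : nat := x \in M; pose g x := (x \in Q) * w x.
have gK x : g x <= K.
  by rewrite /g; case: (x \in Q); rewrite ?mul1n ?mul0n.
have [up _] := mix f g K lam gK; move: up.
have -> : \sum_x f x = #|M|
  by rewrite -sum1_card [RHS]big_mkcond; apply: eq_bigr => x _; rewrite /f; case: ifP.
have -> : \sum_x f x ^ 2 = #|M|
  by rewrite -sum1_card [RHS]big_mkcond; apply: eq_bigr => x _; rewrite /f; case: ifP.
have -> : \sum_x g x = \sum_(u in Q) w u.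
  by rewrite [RHS]big_mkcond; apply: eq_bigr => x _; rewrite /g; case: ifP; rewrite ?mul1n.
move=> up; apply: leq_trans (leq_add (leqnn _) up).
rewrite -mulnDr leq_mul2l; apply/orP; right.
apply: leq_trans (_ : \sum_(x in M) wdeg H w U x <= _).
  by rewrite -sum_nat_const; apply: leq_sum.
have -> : \sum_(x in M) wdeg H w U x =
   \sum_(x in M) wdeg H w (U :\: Q) x + \sum_(x in M) wdeg H w Q x.
  rewrite -big_split; apply: eq_bigr => x _; rewrite /wdeg.
  rewrite EQ (bigID (mem Q)) /= addnC EQ; congr (_ + _); apply: eq_bigl => y.
    by rewrite !inE; case: (y \in U); case: (H x y); case: (D <= _).
  by rewrite !inE; case: (y \in U); case: (H x y); case: (D <= _).
apply: leq_add.
  rewrite /wdeg (exchange_big_dep (mem (U :\: Q))) /=; last by move=> x u _ /andP[].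
  apply: leq_trans (_ : \sum_(u in U :\: Q) D * w u <= _).
    apply: leq_sum => u; rewrite EQ !inE => /andP[nQ uU].
    rewrite sum_nat_const leq_mul2r; apply/orP; right.
    apply: leq_trans (_ : #|[set y in M | H u y]| <= _).
      by apply/subset_leq_card/subsetP => y; rewrite !inE Hsym => /and3P[-> _ ->].
    by move: nQ; rewrite uU /= -ltnNge; apply: ltnW.
  rewrite -big_distrr leq_mul2l; apply/orP; right.
  rewrite [leqRHS](big_setID Q) /= addnC; exact: leq_addr.
rewrite /edge_sum big_mkcond; apply: leq_sum => x _; rewrite /f.
case: ifP => // _; rewrite /wdeg big_mkcond [leqRHS]big_mkcond /=.
apply: leq_sum => y _; rewrite mul1n /g; case: (y \in Q) => //=.
by case: (boolP (H x y)) => // /Hadj ->; rewrite mul1n.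
Qed.

Lemma subset_of_card (R : {set V}) n : n <= #|R| ->
  exists2 M : {set V}, M \subset R & #|M| = n.
Proof.
move=> nR; exists [set x in take n (enum R)].
  by apply/subsetP => x; rewrite inE => /mem_take; rewrite mem_enum.
rewrite cardsE; move/card_uniqP: (take_uniq n (enum_uniq R)) => ->.
by rewrite size_takel // -cardE.
Qed.

End WeightedGraphs.

(** * Robust breadth-first layers *)

Section Layers.
Local Open Scope nat_scope.
Variables (V : finType) (H : rel V) (U Z M : {set V}) (D : nat).

(** Breadth-first search from the seed [M], where a vertex enters a layer only
    when it has at least [D] neighbours in the preceding one.  The pair consists
    of all explored vertices and of the current layer; [Z] is counted as
    explored from the start, which keeps the layers away from it. *)
Fixpoint sweep t : {set V} * {set V} :=
  if t is t'.+1 then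
    let: (E, L) := sweep t' in
    let L' := [set u in U :\: E | D <= #|[set y in L | H u y]|] in
    (E :|: L', L')
  else (Z :|: M, M).
Definition explored t := (sweep t).1.
Definition layer t := (sweep t).2.

Lemma layerS t :
  layer t.+1 = [set u in U :\: explored t | D <= #|[set y in layer t | H u y]|].
Proof. by rewrite /layer /explored /=; case: (sweep t). Qed.

Lemma exploredS t : explored t.+1 = explored t :|: layer t.+1.
Proof. by rewrite /layer /explored /=; case: (sweep t). Qed.

Lemma explored_mono s t : s <= t -> explored s \subset explored t.
Proof.
move/subnKC <-; elim: (t - s) => [|n ih]; first by rewrite addn0.
by rewrite addnS exploredS (subset_trans ih) ?subsetUl.
Qed.

Lemma layer_fresh s t u : s <= t -> u \in layer t.+1 -> u \notin explored s.
Proof.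
move=> st; rewrite layerS !inE => /andP[/andP[uE _] _].
by apply: contraNN uE; apply: subsetP; apply: explored_mono.
Qed.

Lemma layer_alive t : layer t.+1 \subset U.
Proof. by rewrite layerS; apply/subsetP => u; rewrite !inE => /andP[/andP[]]. Qed.

Lemma few_back t u : u \in U -> u \notin explored t.+1 ->
  #|[set y in layer t | H u y]| < D.
Proof.
move=> uU; rewrite exploredS inE negb_or layerS !inE uU ltnNge => /andP[-> /=].
by [].
Qed.

(** Since [explored 0] is excluded, [ball j] is the union of layers 1 to [j]:
    the seed is not part of it. *)
Definition ball j := explored j :\: explored 0.

Lemma ballS j : ball j.+1 = ball j :|: layer j.+1.
Proof.
apply/setP => u; rewrite /ball exploredS !inE.
have [uL|_] := boolP (u \in layer j.+1); last by rewrite !orbF.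
by have := layer_fresh (leq0n j) uL; rewrite /explored /= !inE !orbT => ->.
Qed.

Lemma mem_ball j u : u \in ball j -> exists2 t, t < j & u \in layer t.+1.
Proof.
elim: j => [|j ih]; first by rewrite /ball setDv inE.
rewrite ballS inE => /orP[/ih[t tj ut]|uj]; last by exists j.
by exists t => //; exact: ltnW.
Qed.

Lemma layer_ball j t : t < j -> layer t.+1 \subset ball j.
Proof.
elim: j => // j ih; rewrite ltnS leq_eqVlt ballS => /predU1P[->|/ih h].
  exact: subsetUr.
exact: subset_trans h (subsetUl _ _).
Qed.

Lemma ball_alive j : ball j \subset U.
Proof.
by apply/subsetP => u /mem_ball[t _]; apply: subsetP; exact: layer_alive.
Qed.

(** Two layers of the same parity are equal or at least two steps apart, so few
    edges join them. *)
Definition parity_class b j := \bigcup_(t < j | odd t == b) layer t.+1.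

Lemma parity_classP b j u :
  reflect (exists t, [/\ t < j, odd t = b & u \in layer t.+1])
    (u \in parity_class b j).
Proof.
apply: (iffP bigcupP) => [[t /eqP tb ut]|[t [tj tb ut]]].
  by exists t.
by exists (Ordinal tj); rewrite //= tb.
Qed.

Lemma heavy_parity_class (w : V -> nat) j :
  exists b, \sum_(u in ball j) w u <= 2 * \sum_(u in parity_class b j) w u.
Proof.
have : \sum_(u in ball j) w u <=
    \sum_(u in parity_class true j) w u + \sum_(u in parity_class false j) w u.
  rewrite big_mkcond [X in _ <= X + _]big_mkcond [X in _ <= _ + X]big_mkcond.
  rewrite -big_split /=; apply: leq_sum => u _.
  case: ifP => // /mem_ball[t tj ut].
  have : u \in parity_class (odd t) j by apply/parity_classP; exists t.
  by case: (odd t) => ->; [exact: leq_addr|exact: leq_addl].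
move=> h; have [le|lt] := leqP (\sum_(u in parity_class true j) w u)
    (\sum_(u in parity_class false j) w u).
  by exists false; lia.
by exists true; lia.
Qed.

End Layers.

(** * Numerical estimates *)

Section Arithmetic.
Local Open Scope nat_scope.

(** In the mixing inequality for the total weight [W], the loops, the bad pairs
    and the two error terms each cost at most one eighth of [lam * W ^ 2]. *)
Lemma popular_arith W E S2 B q K s lam : lam = q * K ^ 3 ->
  lam * W * W <= lam * q * (E + S2) + K * (lam ^ 2 * q ^ 2 + q ^ 3 * S2) ->
  S2 <= K * W -> E <= s + K ^ 2 * B -> B <= q ^ 2 * K ^ 5 -> q ^ 2 <= 2 * W ->
  32 * K ^ 7 <= q -> 256 <= K -> W ^ 2 <= 2 * q * s.
Proof.
move=> elam mix hS hE hB hW hq hK.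
have q_gt0 : 0 < q by apply: leq_trans hq; rewrite muln_gt0 expn_gt0; lia.
have lam_gt0 : 0 < lam by rewrite elam muln_gt0 q_gt0 expn_gt0; lia.
have WW : q ^ 2 * q ^ 2 <= 4 * (W * W) by have := leq_mul hW hW; lia.
have hq4 : 32 * K ^ 4 <= q.
  by apply: leq_trans hq; rewrite leq_mul2l leq_exp2l //; lia.
have hq2 : 16 * K <= q.
  apply: leq_trans hq4; apply: leq_mul => //; rewrite -{1}[K]expn1 leq_exp2l; lia.
have t1 : 8 * (lam * q * S2) <= lam * (W * W).
  have h : 16 * K * q <= 2 * W by apply: leq_trans hW; rewrite expnS expn1 leq_mul2r hq2 orbT.
  have h2 : q * S2 <= q * (K * W) by rewrite leq_mul2l hS orbT.
  have h3 := leq_mul (leqnn W) h.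
  rewrite -!mulnA mulnCA leq_mul2l; apply/orP; right; lia.
have t2 : 8 * (lam * q * (K ^ 2 * B)) <= lam * (W * W).
  rewrite -!mulnA mulnCA leq_mul2l; apply/orP; right.
  have h : K ^ 2 * B <= K ^ 2 * (q ^ 2 * K ^ 5) by rewrite leq_mul2l hB orbT.
  have h2 := leq_mul (leqnn (8 * q)) h.
  have h3 := leq_mul (leqnn (q ^ 3)) hq.
  have e7 : K ^ 7 = K ^ 2 * K ^ 5 by rewrite -expnD.
  rewrite e7 in h3; lia.
have t3 : 8 * (K * (lam ^ 2 * q ^ 2)) <= lam * (W * W).
  have -> : 8 * (K * (lam ^ 2 * q ^ 2)) = lam * (8 * (K * (lam * q ^ 2))) by lia.
  rewrite leq_mul2l; apply/orP; right.
  have := leq_mul (leqnn (q ^ 3)) hq4; rewrite elam; lia.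
have t4 : 8 * (K * (q ^ 3 * S2)) <= lam * (W * W).
  have h : K * (q ^ 3 * S2) <= K * (q ^ 3 * (K * W)) by rewrite !leq_mul2l hS !orbT.
  have h1 : 16 * (K ^ 2 * q ^ 3 * W) <= K ^ 3 * q * q ^ 2 * W.
    have -> : K ^ 3 * q * q ^ 2 * W = K * (K ^ 2 * q ^ 3 * W) by lia.
    by rewrite leq_mul2r; apply/orP; right; lia.
  have h2 : K ^ 3 * q * q ^ 2 * W <= K ^ 3 * q * (2 * W) * W.
    by rewrite leq_mul2r leq_mul2l hW !orbT.
  rewrite elam; lia.
have h : lam * q * E <= lam * q * s + lam * q * (K ^ 2 * B).
  by rewrite -mulnDr leq_mul2l hE orbT.
have : lam * (W * W) <= lam * (2 * q * s) by lia.
by rewrite leq_mul2l -mulnn; case: eqP => // e; rewrite e in lam_gt0.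
Qed.

(** The same balance for the edges leaving the seed: sparse end vertices, the
    initially explored set (of weight [B]) and the two error terms cost at most
    one eighth of the main term each. *)
Lemma first_layer_arith k D W L1 B q m K t lam : lam = q * K ^ 2 ->
  lam * q * (m * t) <= lam * q * (D * W) +
    (lam * m * (L1 + B) + K * (lam ^ 2 * q ^ 2 + q ^ 3 * m)) ->
  W <= 16 * q * k * t -> m = q * K ^ 4 -> B <= 3 * K * m -> q ^ 2 <= 2 * W ->
  128 * k * D <= K ^ 4 -> 256 * k <= K -> 0 < k -> 768 * K ^ 6 <= q -> W <= 32 * k * L1.
Proof.
move=> elam mix hW em hB hW2 hD hk k_gt0 hq.
have K_gt0 : 0 < K by lia.
have q_gt0 : 0 < q by apply: leq_trans hq; rewrite muln_gt0 expn_gt0 K_gt0.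
have lam_gt0 : 0 < lam by rewrite elam muln_gt0 q_gt0 expn_gt0 K_gt0.
have m_gt0 : 0 < m by rewrite em muln_gt0 q_gt0 expn_gt0 K_gt0.
have main : lam * (m * W) <= 16 * k * (lam * q * (m * t)).
  have := leq_mul (leqnn (lam * m)) hW; lia.
have t1 : 8 * (16 * k * (lam * q * (D * W))) <= lam * (m * W).
  have := leq_mul (leqnn (lam * q * W)) hD; rewrite em; lia.
have t2 : 8 * (16 * k * (lam * m * B)) <= lam * (m * W).
  have h1 := leq_mul (leqnn (16 * k * (lam * m))) hB.
  have h2 := leq_mul hk (leqnn (3 * K * m)).
  have h3 := leq_mul (leqnn q) hq.
  have e6 : K ^ 6 = K * K * K ^ 4 by rewrite -mulnA -!expnS.
  have h4 : 128 * k * (3 * K * m) <= W by rewrite em; lia.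
  have := leq_mul (leqnn (lam * m)) h4; lia.
have t3 : 8 * (16 * k * (K * (lam ^ 2 * q ^ 2))) <= lam * (m * W).
  have h1 := leq_mul (leqnn (lam * m)) hW2.
  have h2 := leq_mul hk (leqnn (lam * q ^ 2 * q * K ^ 3)).
  rewrite em elam in h1 h2 *; lia.
have t4 : 8 * (16 * k * (K * (q ^ 3 * m))) <= lam * (m * W).
  have h1 := leq_mul (leqnn (lam * m)) hW2.
  have h2 := leq_mul hk (leqnn (m * q ^ 3 * K)).
  rewrite elam in h1 h2 *; lia.
have mix2 := leq_mul (leqnn (16 * k)) mix.
have : lam * m * W <= lam * m * (32 * k * L1) by lia.
by rewrite leq_mul2l muln_eq0 => /orP[/orP[]/eqP|//]; lia.
Qed.
(** If every step multiplied [b] by more than 128, then after [2 * l - 3] steps it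
    would exceed [128 ^ (2 * l - 3) * b 1], which is at least
    [32 * 2 ^ l * b 1] and hence at least [W].  A logarithmic number of steps
    thus turns a loss factor of order [k] into a constant one. *)
Lemma slow_growth (b : nat -> nat) W k l : (forall j, b j <= W) ->
    W <= 32 * k * b 1 -> 0 < W -> k <= 2 ^ l -> 2 <= l ->
  exists2 j, 0 < j <= 2 * l - 3 & b j.+1 <= 128 * b j.
Proof.
move=> bW W1 W_gt0 kl l2.
have [/existsP[[j jl] /= bj]|/existsPn h] :=
  boolP [exists j : 'I_(2 * l - 3), b j.+2 <= 128 * b j.+1].
  by exists j.+1.
have grow n : n < 2 * l - 3 -> 128 ^ n.+1 * b 1 < b n.+2.
  elim: n => [|n ih] nl; have := h (Ordinal nl); rewrite /= -ltnNge; first by rewrite expn1.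
  by have := ih (ltnW nl); rewrite [128 ^ n.+2]expnS; lia.
have := grow (2 * l - 4); have -> : (2 * l - 4).+1 = 2 * l - 3 by lia.
move=> /(_ (leqnn _)).
have := bW (2 * l - 3).+1.
have : 32 * 2 ^ l <= 128 ^ (2 * l - 3).
  by rewrite (_ : 128 = 2 ^ 7) // -expnM (_ : 32 = 2 ^ 5) // -expnD leq_exp2l //; lia.
move=> h1 h2 h3.
have h4 := leq_mul (leqnn (32 * b 1)) kl.
have := leq_mul h1 (leqnn (b 1)); lia.
Qed.

Lemma core_degree_arith W q k K : q = K ^ 12 -> 256 * k <= K -> 0 < k ->
  q ^ 2 <= 2 * W -> K * (K ^ 8 + 2) <= W %/ (8 * q * k).
Proof.
move=> eq hk k_gt0 hW; have K_gt0 : 0 < K by lia.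
rewrite leq_divRL; last by rewrite !muln_gt0 k_gt0 eq expn_gt0 K_gt0.
have h1 : K * (K ^ 8 + 2) <= 2 * K ^ 9.
  have -> : K ^ 9 = K * K ^ 8 by rewrite -expnS.
  have : 2 <= K ^ 8 by apply: leq_trans (_ : K ^ 1 <= _); [lia|rewrite leq_exp2l; lia].
  by move=> h; have := leq_mul (leqnn K) h; lia.
have h2 := leq_mul h1 (leqnn (8 * q * k)).
have h3 := leq_mul (leqnn (K ^ 9 * q)) hk.
have h4 : K ^ 9 * q * K <= q ^ 2.
  rewrite -mulnA mulnC -mulnA -mulnn leq_mul2l -expnS; apply/orP; right.
  by rewrite eq leq_exp2l; lia.
lia.
Qed.
End Arithmetic.

(** * Eliminating colours *)

Lemma leq_sum_subset (T : finType) (A B : {set T}) (w : T -> nat) :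
  A \subset B -> (\sum_(u in A) w u <= \sum_(u in B) w u)%N.
Proof.
move=> AB; rewrite [leqRHS](big_setID A) /= (setIidPr AB); exact: leq_addr.
Qed.

Lemma sum_disjointU (T : finType) (A B : {set T}) (w : T -> nat) :
  [disjoint A & B] ->
  (\sum_(u in A :|: B) w u = \sum_(u in A) w u + \sum_(u in B) w u)%N.
Proof.
move=> AB; rewrite (big_setID A) /= setUK; congr (_ + _)%N.
by rewrite setDUl setDv set0U (setDidPl _) // disjoint_sym.
Qed.

Section Descent.
Local Open Scope nat_scope.
Variables (G : sgraph) (k q : nat) (c : {set G} -> 'I_k).
Local Notation K := (256 ^ k).
Local Notation lists := (G -> {set 'I_k}).
Implicit Types (U : {set G}) (S : lists).

(** A state consists of a set [U] of alive vertices and a list [S x] of colours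
    for every vertex.  An edge is good when its colour is still listed at both of
    its ends; an alive pair that is adjacent but not good is bad, and bad pairs
    are kept negligible in number. *)
Definition good U S : rel G := fun x y => [&& x \in U, y \in U, adj x y,
  c [set x; y] \in S x & c [set x; y] \in S y].

Definition good_in U S (i : 'I_k) : rel G :=
  fun x y => good U S x y && (c [set x; y] == i).

Definition bad U S : {set G * G} :=
  [set p | [&& p.1 \in U, p.2 \in U, adj p.1 p.2 & ~~ good U S p.1 p.2]].

(** Losing a colour multiplies the weight of a vertex by 256, which compensates
    for keeping only a fraction 1/256 of the weight of a ball. *)
Definition weight S u := 256 ^ (k - #|S u|).

Definition total U S := \sum_(u in U) weight S u.

Definition potential U S := \sum_(u in U) #|S u|.

Lemma weight_le S u : weight S u <= K.
Proof. by rewrite leq_exp2l // leq_subr. Qed.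

Lemma good_in_sym U S i : symmetric (good_in U S i).
Proof.
move=> x y; rewrite /good_in /good adj_sym setUC; congr (_ && _).
by rewrite andbCA; congr [&& _, _, _ & _]; rewrite andbC.
Qed.

Lemma good_in_adj U S i : subrel (good_in U S i) (@adj G).
Proof. by move=> x y /andP[/and5P[]]. Qed.

Lemma good_in_irr U S i : irreflexive (good_in U S i).
Proof. by move=> x; apply/negP => /good_in_adj; rewrite adj_irr. Qed.

Lemma good_inP U S i x y : good_in U S i x y ->
  [/\ x \in U, y \in U, i \in S x & i \in S y].
Proof. by move=> /andP[/and5P[xU yU _ cx cy] /eqP <-]. Qed.

Hypothesis mix : mixing (@adj G) q.
Hypothesis k_gt0 : 0 < k.

(** By mixing, the weighted number of edges inside [U] is about [W ^ 2 / q] where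
    [W] is the total weight; bad pairs are few, so that one of the [k] colours
    carries its share of the good edges. *)
Lemma popular_colour U S : q ^ 2 <= 2 * total U S ->
    #|bad U S| <= q ^ 2 * K ^ 5 -> 32 * K ^ 7 <= q -> 256 <= K ->
  exists i, total U S ^ 2 <=
    2 * q * k * \sum_(x in U) weight S x * wdeg (good_in U S i) (weight S) U x.
Proof.
move=> hW hB hq hK; pose w := weight S.
pose e i := \sum_(x in U) w x * wdeg (good_in U S i) w U x.
have eE i : e i = \sum_x \sum_y good_in U S i x y * (w x * w y).
  rewrite /e big_mkcond; apply: eq_bigr => x _.
  rewrite /wdeg big_distrr big_mkcond /=.
  case: ifP => xU.
    rewrite big_mkcond; apply: eq_bigr => y _.
    case: (boolP (good_in U S i x y)) => [/good_inP[_ -> _ _]|_].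
      by rewrite mul1n.
    by rewrite andbF.
  rewrite big1 // => y _; case: (boolP (good_in _ _ _ _ _)) => //.
  by move=> /good_inP[]; rewrite xU.
pose f x := (x \in U) * w x.
have fK x : f x <= K.
  by rewrite /f; case: (x \in U); rewrite ?mul1n ?mul0n// weight_le.
have [_] := @mix f f K (q * K ^ 3) fK.
have -> : \sum_x f x = total U S.
  by rewrite [RHS]big_mkcond; apply: eq_bigr => x _; rewrite /f; case: ifP; rewrite ?mul1n.
have -> : \sum_x f x ^ 2 = \sum_x f x * f x by apply: eq_bigr => x _; rewrite mulnn.
have f2 : \sum_x f x * f x <= K * total U S.
  rewrite /total [X in _ * X]big_mkcond big_distrr; apply: leq_sum => x _ /=.
  rewrite /f; case: ifP => _; rewrite ?muln0 ?mul0n// mul1n leq_mul2r.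
  by rewrite weight_le orbT.
have hE : edge_sum (@adj G) f f <= \sum_i e i + K ^ 2 * #|bad U S|.
  have -> : \sum_i e i = \sum_x \sum_y \sum_i good_in U S i x y * (w x * w y).
    rewrite (eq_bigr _ (fun i _ => eE i)) exchange_big; apply: eq_bigr => x _.
    by rewrite exchange_big.
  have -> : K ^ 2 * #|bad U S| = \sum_x \sum_y ((x, y) \in bad U S) * K ^ 2.
    rewrite -sum1_card big_distrr pair_big [LHS]big_mkcond /=.
    by apply: eq_bigr => -[x y] _ /=; case: ifP; rewrite ?muln1 ?mul1n.
  rewrite -big_split /edge_sum; apply: leq_sum => x _.
  rewrite -big_split big_mkcond; apply: leq_sum => y _ /=.
  case: ifP => // xy; rewrite /f.
  case: (boolP (x \in U)) => xU; last by rewrite mul0n.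
  case: (boolP (y \in U)) => yU; last by rewrite mul0n muln0.
  rewrite !mul1n; case: (boolP (good U S x y)) => gd.
    rewrite (bigD1 (c [set x; y])) //= /good_in gd eqxx mul1n.
    by rewrite -addnA leq_addr.
  rewrite [X in _ <= _ + X](_ : _ = K ^ 2).
    apply: leq_trans (leq_addl _ _); rewrite -mulnn; apply: leq_mul; exact: weight_le.
  by rewrite inE /= xU yU xy gd mul1n.
move=> hmix; have := popular_arith erefl hmix f2 hE hB hW hq hK.
move=> h; apply/existsP; apply: contraT; rewrite negb_exists => /forallP nope.
have {}nope i : ~~ (total U S ^ 2 <= 2 * q * k * e i) := nope i.
clearbody e; have : \sum_(i < k) (2 * q * k * e i).+1 <= \sum_(i < k) total U S ^ 2.
  by apply: leq_sum => i _; rewrite ltnNge; exact: nope.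
under eq_bigr => i _ do rewrite -addn1.
rewrite big_split -big_distrr /= !sum_nat_const card_ord muln1.
have := leq_mul (leqnn k) h.
move: (total U S ^ 2) (\sum_i e i) => W s; lia.
Qed.

Variable l : nat.
Hypothesis C4free : forall x y a b : G, x != y ->
  adj x a -> adj y a -> adj x b -> adj y b -> a = b.
Hypothesis degree : forall x : G, #|[set y | adj x y]| <= q.
Hypothesis order : #|G| = q * q.
Hypothesis qE : q = K ^ 12.
Hypotheses (K_big : 256 * k <= K) (l_ge2 : 2 <= l) (l_le : l <= k) (k_le : k <= 2 ^ l).
Hypothesis nocycle : forall i (H : rel G),
  (forall x y, H x y -> adj x y /\ c [set x; y] = i) -> symmetric H ->
  forall v p t, t < 2 * l - 3 -> size p = t.*2 + 6 -> ~ closes (@adj G) H v p.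

Local Notation D := (12 * l).

Let K_ge : 256 <= K.
Proof. by apply: leq_trans K_big; rewrite -{1}[256]muln1 leq_mul2l. Qed.

Let q_big n m : n <= 11 -> m <= 256 -> m * K ^ n <= q.
Proof.
move=> n11 mK; rewrite qE; apply: leq_trans (_ : K * K ^ n <= _).
  by rewrite leq_mul2r (leq_trans mK K_ge) orbT.
by rewrite -expnS leq_exp2l // (leq_trans _ K_ge).
Qed.

(** The seed lies in a core of large minimum weighted degree in colour [i], at
    distance two from the root [v] along that colour.  A single neighbourhood
    would be too small for the mixing inequality to say anything about the next
    layer; a second neighbourhood is large enough.  The value of [t] is at
    most a quarter of the average weighted degree in colour [i]. *)
Lemma seed_exists U S i : q ^ 2 <= 2 * total U S ->
    total U S ^ 2 <=
      2 * q * k * \sum_(x in U) weight S x * wdeg (good_in U S i) (weight S) U x ->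
  let H := good_in U S i in let t := total U S %/ (8 * q * k) in
  exists v (M : {set G}), [/\ #|M| = q * K ^ 4,
    {in M, forall u, (u != v) && ~~ adj v u},
    {in M, forall u, exists2 x, H v x & H x u} &
    {in M, forall u, t <= wdeg H (weight S) U u}].
Proof.
move=> hW hi H t; set w := weight S; set W := total U S in hW hi t *.
have q_gt0 : 0 < q by rewrite qE !expn_gt0.
have W_gt0 : 0 < W.
  move: hW; rewrite lt0n; case: eqP => // ->.
  by rewrite muln0 leqn0 expn_eq0 -leqn0 leqNgt q_gt0.
have tW : 8 * q * k * t <= W by rewrite mulnC leq_trunc_div.
have [|||X [XU /set0Pn[v vX] Xt]] := @dense_core _ H w U t.
- exact: good_in_sym.
- exact: good_in_irr.
- rewrite -/w -[\sum_(x in U) w x]/W.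
  move: hi; rewrite -/H -/w; move: (\sum_(x in U) _) => s hi.
  rewrite ltnNge; apply/negP => hs.
  have h1 := leq_mul (leqnn (2 * q * k)) hs.
  have h2 := leq_mul tW (leqnn W).
  have h3 : 0 < W * W by rewrite muln_gt0 W_gt0.
  by clear - hi h1 h2 h3; lia.
have degX : {in X, forall x, K ^ 8 + 2 <= #|[set y in X | H x y]|}.
  move=> x xX; rewrite -(@leq_pmul2l K) ?(leq_trans _ K_ge)//.
  apply: leq_trans (core_degree_arith qE K_big k_gt0 hW) _.
  apply: leq_trans (Xt x xX) _; rewrite mulnC -sum_nat_const /wdeg.
  rewrite [leqRHS](eq_bigl (fun y => (y \in X) && H x y)); last by move=> y; rewrite inE.
  by apply: leq_sum => y _; exact: weight_le.
have [|M MR cM] := @subset_of_card G _ (q * K ^ 4) (_ : _ <=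
    #|[set u in X | [&& u != v, ~~ adj v u & [exists x, H v x && H x u]]]|).
  rewrite qE -expnD; have := second_neighbourhood (@adj_sym G) (@adj_irr G) C4free
    (@good_in_adj U S i) vX degX.
  by rewrite -expnD.
have {}MR u : u \in M -> [/\ u \in X, u != v, ~~ adj v u & exists2 x, H v x & H x u].
  move=> /(subsetP MR); rewrite inE => /and4P[-> -> -> /existsP[x /andP[vx xu]]].
  by split=> //; exists x.
exists v, M; split=> //.
- by move=> u /MR[_ -> ->].
- by move=> u /MR[].
- move=> u /MR[uX _ _ _]; apply: leq_trans (Xt u uX) _.
  rewrite /wdeg big_mkcond [leqRHS]big_mkcond; apply: leq_sum => y _ /=.
  by case: (boolP (y \in X)) => // /(subsetP XU) ->.
Qed.

(** One elimination of a colour.  Around the root the layers of a popular colour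
    [i] grow from weight [W / (32 * k)], hence some ball [B j] with
    [j <= 2 * l - 3] keeps a fraction 1/128 of the weight of [B j.+1].  A layer
    spans no good edge of colour [i], as such an edge would close to a short
    induced odd cycle.  The heavier parity class [P] of [B j] therefore meets few
    good edges of colour [i] once the rest of [B j.+1] is deleted, and the colour
    is struck from its lists.  The total weight drops only by what was explored
    initially, few pairs become bad, and the potential drops by [#|P|], which is
    at least [q ^ 2 / K ^ 2] because no weight exceeds [K]. *)
Lemma descent_step U S : q ^ 2 <= 2 * total U S ->
    #|bad U S| <= q ^ 2 * K ^ 5 ->
  exists U' S', [/\ total U S <= total U' S' + 3 * K * (q * K ^ 4),
    #|bad U' S'| <= #|bad U S| + 2 * (q ^ 2 * (2 * l * D)) &
    K ^ 2 * potential U' S' + q ^ 2 <= K ^ 2 * potential U S].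
Proof.
move=> hW hB.
have [i hi] := popular_colour hW hB (@q_big 7 32 isT isT) K_ge.
have [v [M [cM M_far M_par M_deg]]] := seed_exists hW hi.
set H := good_in U S i in M_par M_deg; set t := _ %/ _ in M_deg.
set w := weight S in M_deg; set W := total U S in hW t M_deg *.
have q_gt0 : 0 < q by rewrite qE !expn_gt0.
have H_adj : subrel H (@adj G) by exact: good_in_adj.
have H_sym : symmetric H by exact: good_in_sym.
pose Z := v |: [set u | adj v u].
pose L := layer H U Z M D; pose E := explored H U Z M D; pose B := ball H U Z M D.
have cE0 : #|E 0| <= 3 * (q * K ^ 4).
  have q1 : 1 <= q by rewrite qE !expn_gt0.
  have K4 : 1 <= K ^ 4 by rewrite !expn_gt0.
  have h1 : q <= q * K ^ 4 by rewrite leq_pmulr.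
  have : #|E 0| <= (1 + q) + q * K ^ 4.
    apply: leq_trans (leq_card_setU _ _).1 _; rewrite cM leq_add2r.
    apply: leq_trans (leq_card_setU _ _).1 _; rewrite cards1 leq_add2l.
    exact: degree.
  by clear - h1 q1; lia.
have L1 : W <= 32 * k * \sum_(u in L 1) w u.
  have hn := @heavy_neighbourhood G (@adj G) H w U M _ q K t D
    (q * K ^ 2) mix H_adj H_sym (@weight_le S) M_deg erefl.
  move: hn; set Q := [set u in U | _] => hn.
  have hQ : \sum_(u in Q) w u <= \sum_(u in L 1) w u + K * #|E 0|.
    rewrite (big_setID (E 0)) /= addnC; apply: leq_add.
      rewrite /L layerS; apply: eq_leq; apply: eq_bigl => u; rewrite !inE.
      by rewrite andbA.
    apply: leq_trans (_ : \sum_(u in E 0) w u <= _).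
      by rewrite [leqRHS](big_setID Q) /= setIC leq_addr.
    by rewrite mulnC -sum_nat_const; apply: leq_sum => u _; exact: weight_le.
  apply: (@first_layer_arith k D W _ (K * #|E 0|) q (q * K ^ 4) K t _ erefl) => //.
  - rewrite cM in hn; apply: leq_trans hn _; rewrite leq_add2l leq_add2r.
    by rewrite leq_mul2l hQ orbT.
  - have := divn_eq W (8 * q * k); rewrite -/t.
    have := core_degree_arith qE K_big k_gt0 hW; rewrite -/t.
    have : 0 < 8 * q * k by rewrite !muln_gt0 k_gt0 qE !expn_gt0.
    move=> h0; have := ltn_pmod W h0; move: (W %% _) => r hr ht eW.
    have t1 : 1 <= t by apply: leq_trans ht; rewrite muln_gt0 expn_gt0 addn2 andbT.
    have := leq_mul t1 (leqnn (8 * q * k)).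
    by clear - eW hr; lia.
  - by rewrite (mulnC 3) -mulnA leq_mul2l cE0 orbT.
  - have h1 := leq_mul K_big K_big; have h2 := leq_mul (leqnn k) l_le.
    apply: leq_trans (_ : K * K <= _); first by clear - h1 h2; lia.
    by rewrite mulnn leq_exp2l // (leq_trans _ K_ge).
  - apply: leq_trans (@q_big 7 256 isT isT).
    have : 3 * K ^ 6 <= K ^ 7 by rewrite expnS leq_mul2r (leq_trans _ K_ge) ?orbT.
    by clear; lia.
have W_gt0 : 0 < W.
  by have := q_gt0; move: hW; case: (W) => //; rewrite muln0 leqn0 expn_eq0 => /andP[/eqP->].
have [||j /andP[j_gt0 j_le] growth] :=
  @slow_growth (fun j => \sum_(u in B j) w u) W k l _ _ W_gt0 k_le l_ge2.
- by move=> j; apply: leq_sum_subset; exact: ball_alive.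
- apply: leq_trans L1 _; rewrite leq_mul2l; apply/orP; right.
  by apply: leq_sum_subset; exact: layer_ball.
have [b hb] := heavy_parity_class H U Z M D w j.
set P := parity_class H U Z M D b j in hb.
(* Nothing of [B j.+1] survives except [P], so that no surviving vertex outside
   [P] has [D] neighbours of colour [i] in a layer that meets [P]. *)
pose U' := (U :\: E j.+1) :|: P.
pose S' u := if u \in P then S u :\ i else S u.
have PB : P \subset B j.
  by apply/subsetP => u /parity_classP[s [sj _]]; apply: subsetP; exact: layer_ball.
have PU : P \subset U by apply: subset_trans PB _; exact: ball_alive.
have PE : P \subset E j.+1.
  apply: subset_trans PB _; apply: subset_trans (subsetDl _ _) _.
  exact: explored_mono.
have U'P : [disjoint U :\: E j.+1 & P].
  rewrite disjoint_sym disjoints_subset; apply: subset_trans PE _.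
  by rewrite setDE setCI setCK subsetUr.
have UU' : U' \subset U by rewrite subUset subsetDl.
have iS u : u \in P -> i \in S u.
  move=> /parity_classP[s [_ _]]; rewrite layerS inE => /andP[_].
  case: (set_0Vmem [set y in layer H U Z M D s | H u y]) => [->|[y]].
    by rewrite cards0; lia.
  by rewrite inE => /andP[_ /good_inP[]].
have notP u : u \in U :\: E j.+1 -> u \notin P.
  by move=> uU; have := disjointFr U'P uU => ->.
have total' : total U' S' = \sum_(u in U :\: E j.+1) w u + 256 * \sum_(u in P) w u.
  rewrite /total sum_disjointU //; congr (_ + _).
    by apply: eq_bigr => u /notP uP; rewrite /weight /S' (negPf uP).
  rewrite big_distrr /=; apply: eq_bigr => u uP.
  rewrite /weight /S' uP /w /weight -expnS; congr (_ ^ _).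
  have cS : #|S u :\ i| < k.
    by have := max_card (S u); rewrite card_ord (cardsD1 i) iS.
  by rewrite [in RHS](cardsD1 i) iS // add1n subnSK.
exists U', S'; split.
- rewrite total' /W /total (big_setID (E j.+1)) /= addnC.
  have h1 : \sum_(u in U :&: E j.+1) w u <=
      \sum_(u in B j.+1) w u + \sum_(u in E 0) w u.
    rewrite -sum_disjointU; last first.
      by rewrite disjoint_sym disjoints_subset /B /ball setDE setCI setCK subsetUr.
    apply: leq_sum_subset; apply/subsetP => u; rewrite !inE => /andP[_ ->].
    by rewrite andbT orNb.
  have h2 : \sum_(u in E 0) w u <= K * #|E 0|.
    by rewrite mulnC -sum_nat_const; apply: leq_sum => u _; exact: weight_le.
  have h3 := leq_mul (leqnn K) cE0.
  rewrite -addnA leq_add2l; apply: leq_trans h1 _; apply: leq_add.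
    apply: leq_trans growth _; rewrite -[256]/(128 * 2) -mulnA leq_mul2l /=; exact: hb.
  by apply: leq_trans h2 _; apply: leq_trans h3 _; rewrite mulnA (mulnC 3).
(* Up to orientation, a pair that becomes bad joins a layer [s.+1] to an alive
   vertex that stayed out of layer [s.+2] although it was still available. *)
- pose N := [set p : G * G | [exists s : 'I_j, [&& p.1 \in L s.+1, p.2 \in U,
     p.2 \notin E s.+2 & H p.2 p.1]]].
  have cN : #|N| <= q ^ 2 * (2 * l * D).
    pose C (ys : G * 'I_j) := if (ys.1 \in U) && (ys.1 \notin E ys.2.+2)
      then [set (x, ys.1) | x in [set x in L ys.2.+1 | H ys.1 x]] else set0.
    apply: leq_trans (_ : D * size (enum {: G * 'I_j}) <= _).
      apply: (@card_le_cover (G * 'I_j)%type _ (enum {: G * 'I_j}) C N D) => [[y s] _|[x y]].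
        rewrite /C /=; case: ifP => [/andP[yU yE]|]; last by rewrite cards0.
        apply: leq_trans (leq_imset_card _ _) _; apply: ltnW; exact: few_back.
      rewrite inE => /existsP[s /and4P[/= xL yU yE xy]].
      exists (y, s); first by rewrite mem_enum.
      by rewrite /C /= yU yE; apply/imsetP; exists x; rewrite // inE xL.
    rewrite -cardE card_prod card_ord order -mulnn mulnC -mulnA leq_mul2l.
    apply/orP; right; rewrite leq_mul2r; apply/orP; right.
    by clear - j_le; lia.
  have new x y : x \in P -> y \in U' -> H x y -> ((x, y) \in N) || ((y, x) \in N).
    move=> /parity_classP[s [sj sb xL]]; rewrite in_setU => /orP[|].
      rewrite inE => /andP[yE yU] xy; apply/orP; left; rewrite inE.
      apply/existsP; exists (Ordinal sj); rewrite /= xL yU H_sym xy andbT /=.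
      by apply: contraNN yE; apply: subsetP; exact: explored_mono.
    move=> /parity_classP[s' [sj' sb' yL]] xy.
    have yU : y \in U by apply: (subsetP (layer_alive H U Z M D s')).
    have xU : x \in U by apply: (subsetP (layer_alive H U Z M D s)).
    have gap (m n : nat) : odd m = odd n -> m < n -> m.+2 <= n.
      by move=> mn; rewrite leq_eqVlt => /predU1P[e|//]; move: mn; rewrite -e /=; case: odd.
    case: (ltngtP s s') => [ss'|s's|e].
    - apply/orP; left; rewrite inE; apply/existsP; exists (Ordinal sj).
      rewrite /= xL yU H_sym xy andbT /=; apply: layer_fresh yL.
      by apply: gap; rewrite ?sb.
    - apply/orP; right; rewrite inE; apply/existsP; exists (Ordinal sj').
      rewrite /= yL xU xy andbT /=; apply: layer_fresh xL.
      by apply: gap; rewrite ?sb.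
    exfalso; rewrite -e in yL.
    have [||||p cp sp] := layer_edge_closes (@adj_sym G) (@adj_irr G) C4free
      H_sym H_adj (v := v) (L := L) (D := D) _ _ _ xL yL xy.
    + move=> [|r] u ur; first exact: M_far.
      have := layer_fresh (leq0n r) ur.
      by rewrite /explored /= !inE !negb_or -andbA => /and3P[-> -> _].
    + exact: M_par.
    + by move=> r u; rewrite /L layerS inE => /andP[].
    + by clear - sj j_le l_ge2; lia.
    apply: (nocycle (i := i) (H := H) _ H_sym _ sp cp).
      by move=> x' y' /[dup] /H_adj ? /andP[_ /eqP].
    exact: leq_trans sj j_le.
  apply: leq_trans (_ : #|bad U S :|: (N :|: [set (p.2, p.1) | p in N])| <= _).
    apply/subset_leq_card/subsetP => -[x y]; rewrite inE => /and4P[/= xU yU xy].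
    have [gd|gd _] := boolP (good U S x y); last first.
      by rewrite !inE /= gd xy !(subsetP UU').
    rewrite /good xU yU xy /= negb_and => bd.
    have [Hxy Pxy] : H x y /\ ((x \in P) || (y \in P)).
      have lost z : c [set x; y] \in S z -> c [set x; y] \notin S' z ->
        z \in P /\ c [set x; y] = i.
        rewrite /S'; case: ifP => [_ zS|_ ->//].
        by rewrite in_setD1 zS andbT negbK => /eqP.
      have /and5P[_ _ _ cx cy] := gd; rewrite /H /good_in gd.
      by case/orP: bd => /lost[] // zP ->; rewrite zP ?orbT eqxx.
    have : ((x, y) \in N) || ((y, x) \in N).
      case/orP: Pxy => [xP|yP]; first exact: new.
      by rewrite orbC; apply: new => //; rewrite H_sym.
    case/orP => [xyN|yxN]; rewrite !in_setU ?xyN ?orbT //.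
    by apply/orP; right; apply/orP; right; apply/imsetP; exists (y, x).
  apply: leq_trans (leq_card_setU _ _).1 _; rewrite leq_add2l mul2n -addnn.
  apply: leq_trans (leq_card_setU _ _).1 _; apply: leq_add => //.
  exact: leq_trans (leq_imset_card _ _) cN.
- have hPhi : potential U' S' + #|P| <= potential U S.
    rewrite /potential sum_disjointU // -addnA.
    apply: leq_trans (_ : \sum_(u in U :\: E j.+1) #|S u| + \sum_(u in P) #|S u| <= _).
      apply: leq_add.
        by apply: leq_sum => u /notP uP; rewrite /S' (negPf uP).
      rewrite -sum1_card -big_split; apply: leq_sum => u uP /=.
      by rewrite /S' uP (cardsD1 i (S u)) iS // addnC.
    by rewrite -sum_disjointU //; apply: leq_sum_subset.
  have cP : \sum_(u in P) w u <= K * #|P|.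
    by rewrite mulnC -sum_nat_const; apply: leq_sum => u _; exact: weight_le.
  have hL1 : \sum_(u in L 1) w u <= \sum_(u in B j) w u.
    by apply: leq_sum_subset; exact: layer_ball.
  have q2 : q ^ 2 <= K ^ 2 * #|P|.
    have h1 := leq_mul (leqnn (64 * k)) cP.
    have h2 := leq_mul (leqnn (32 * k)) (leq_trans hL1 hb).
    have h3 := leq_mul K_big (leqnn (K * #|P|)).
    by rewrite -mulnn -mulnA; clear - hW L1 h1 h2 h3; lia.
  apply: leq_trans (_ : K ^ 2 * (potential U' S' + #|P|) <= _).
    by rewrite mulnDr leq_add2l.
  by rewrite leq_mul2l hPhi orbT.
Qed.

(** The range of [n] is chosen so that the accumulated losses stay within the
    hypotheses of [descent_step] until the potential is used up. *)
Lemma descent n : n <= k * K ^ 2 + 1 -> exists U S,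
  [/\ q ^ 2 <= total U S + n * (3 * K * (q * K ^ 4)),
      #|bad U S| <= n * (2 * (q ^ 2 * (2 * l * D))) &
      K ^ 2 * potential U S + n * q ^ 2 <= K ^ 2 * (k * q ^ 2)].
Proof.
elim: n => [_|n ih nk].
  exists setT, (fun=> setT); split.
  - rewrite /total addn0 (eq_bigr (fun=> 1)) => [|u _].
      by rewrite sum1_card cardsT order mulnn.
    by rewrite /weight cardsT card_ord subnn.
  - rewrite leqn0 cards_eq0; apply/eqP/setP => -[x y].
    by rewrite !inE /good /= !inE; case: adj.
  - rewrite addn0 /potential (eq_bigr (fun=> k)) => [|u _].
      by rewrite sum_nat_const cardsT order mulnn [q ^ 2 * k]mulnC.
    by rewrite cardsT card_ord.
have [U [S [hW hB hPhi]]] := ih (ltnW nk).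
have K_gt0 : 0 < K by rewrite expn_gt0.
have nK : n <= K ^ 3.
  apply: leq_trans (_ : k * K ^ 2 <= _); first by rewrite addn1 in nk.
  rewrite [K ^ 3]expnS leq_mul2r (leq_trans _ K_big) ?orbT //.
  by rewrite leq_pmull.
have [||U' [S' [hW' hB' hPhi']]] := @descent_step U S.
- have h1 := @q_big 8 6 isT isT.
  have h2 : n * (3 * K * (q * K ^ 4)) <= K ^ 3 * (3 * K * (q * K ^ 4)).
    by rewrite leq_mul2r nK orbT.
  have e8 : K ^ 8 = K ^ 3 * (K * K ^ 4) by rewrite -expnS -expnD.
  rewrite e8 in h1; have h3 := leq_mul (leqnn q) h1.
  by rewrite -mulnn in hW *; clear - hW h2 h3; lia.
- apply: leq_trans hB _.
  have h1 := leq_mul K_big K_big; have h2 := leq_mul l_le l_le.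
  have h3 : 48 * (l * l) <= K ^ 2 by rewrite -[K ^ 2]mulnn; clear - h1 h2; lia.
  have h4 := leq_mul nK h3.
  have e5 : K ^ 5 = K ^ 3 * K ^ 2 by rewrite -expnD.
  rewrite e5; have h5 := leq_mul (leqnn (q ^ 2)) h4.
  by clear - h5; lia.
exists U', S'; split; rewrite mulSn.
- by clear - hW hW'; lia.
- by clear - hB hB'; lia.
- by clear - hPhi hPhi'; lia.
Qed.

Lemma descent_absurd : False.
Proof.
have [U [S [_ _]]] := descent (leqnn _).
have : 0 < q ^ 2 by rewrite qE !expn_gt0.
by rewrite mulnDl mul1n; lia.
Qed.
End Descent.

(** * The host graph *)

Section Host.
Variable F : finFieldType.
Local Notation V := (F * F)%type.
Local Notation q := #|F|.

(** The points (a, b) and (c, d) of the affine plane are incident when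
    b + d = a c: a point is identified with the line that it labels, and two
    distinct lines share at most one point. *)
Definition incident (x y : V) := x.2 + y.2 == x.1 * y.1.
Definition host_adj (x y : V) := (x != y) && incident x y.

Lemma incident_sym : symmetric incident.
Proof. by move=> x y; rewrite /incident addrC mulrC. Qed.

Lemma host_adj_sym : symmetric host_adj.
Proof. by move=> x y; rewrite /host_adj eq_sym incident_sym. Qed.

Lemma host_adj_irr : irreflexive host_adj.
Proof. by move=> x; rewrite /host_adj eqxx. Qed.

Lemma incident_inj x y c d : x != y -> incident x c -> incident y c ->
  incident x d -> incident y d -> c = d.
Proof.
case: x y c d => [x1 x2] [y1 y2] [c1 c2] [d1 d2]; rewrite /incident /= xpair_eqE.
move=> xy /eqP e1 /eqP e2 /eqP e3 /eqP e4.
have e : (x1 - y1) * (c1 - d1) = 0.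
  by rewrite mulrBl !mulrBr -e1 -e2 -e3 -e4; ring.
have {}e : c1 = d1.
  have [xy1|xy1] := eqVneq x1 y1.
    move: xy; rewrite xy1 eqxx /=; rewrite xy1 -e2 in e1.
    by rewrite (addIr _ e1) eqxx.
  have xy0 : x1 - y1 != 0 by rewrite subr_eq0.
  by apply/subr0_eq/(mulfI xy0); rewrite e mulr0.
by rewrite e in e1 *; congr pair; apply: (@addrI _ x2); rewrite e1 e3.
Qed.

Lemma host_C4free x y c d : x != y -> host_adj x c -> host_adj y c ->
  host_adj x d -> host_adj y d -> c = d.
Proof.
by move=> xy /andP[_ xc] /andP[_ yc] /andP[_ xd] /andP[_ yd]; apply: incident_inj xy _ _ _ _.
Qed.

Lemma sum_incident (R : nmodType) (x : V) (h : V -> R) :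
  \sum_(y | incident x y) h y = \sum_c h (c, x.1 * c - x.2).
Proof.
rewrite (reindex_onto (fun c => (c, x.1 * c - x.2)) fst) /=.
  by apply: eq_bigl => c; rewrite /incident /= addrC subrK !eqxx.
move=> [c d]; rewrite /incident /= => /eqP <-.
by rewrite addrC addKr.
Qed.

Lemma card_incident x : #|[set y | incident x y]| = q.
Proof.
rewrite -sum1dep_card.
by rewrite (sum_incident (R := nat) x (fun=> 1%N)) sum1_card.
Qed.

Lemma host_degree x : (#|[set y | host_adj x y]| <= q)%N.
Proof.
rewrite -(card_incident x); apply/subset_leq_card/subsetP => y.
by rewrite !inE => /andP[].
Qed.

Section SecondMoment.
Variable f : V -> int.
Hypothesis f0 : forall x, 0 <= f x.
Let a (x y : V) : int := (incident x y)%:R.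
Let T y := \sum_x a x y * f x.
Let S := \sum_x f x.

Let sum_a x : \sum_y a x y = q%:R.
Proof.
rewrite -(card_incident x) -sum1dep_card natr_sum [RHS]big_mkcond.
by apply: eq_bigr => y _; rewrite /a; case: incident.
Qed.

(** The variance of the number of [f]-weighted neighbours.  Two distinct points
    have at most one common incident point, so the sum of the squares [T y ^ 2] is
    at most [S ^ 2] plus a diagonal contribution. *)
Lemma second_moment :
  \sum_y (q%:R * T y - S) ^+ 2 <= q%:R ^+ 3 * \sum_x f x ^+ 2.
Proof.
have sT : \sum_y T y = q%:R * S.
  rewrite /T exchange_big /= /S mulr_sumr; apply: eq_bigr => x _.
  by rewrite -mulr_suml sum_a.
have sT2 : \sum_y T y ^+ 2 <= S ^+ 2 + q%:R * \sum_x f x ^+ 2.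
  have -> : \sum_y T y ^+ 2 = \sum_x \sum_x' (f x * f x') * \sum_y a x y * a x' y.
    under eq_bigr => y _.
      rewrite expr2 {1}/T mulr_suml; under eq_bigr => x _ do rewrite mulr_sumr.
      over.
    rewrite exchange_big; apply: eq_bigr => x _.
    rewrite exchange_big; apply: eq_bigr => x' _.
    by rewrite mulr_sumr; apply: eq_bigr => y _; ring.
  have -> : S ^+ 2 + q%:R * \sum_x f x ^+ 2 =
      \sum_x \sum_x' (f x * f x') * (1 + (x == x')%:R * q%:R).
    rewrite expr2 {1}/S mulr_suml mulr_sumr -big_split; apply: eq_bigr => x _ /=.
    under [RHS]eq_bigr => x' _ do rewrite mulrDr mulr1.
    rewrite big_split /= mulr_sumr; congr (_ + _).
    rewrite (bigD1 x) //= eqxx mul1r big1 ?addr0 => [|y /negPf].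
      by rewrite expr2 mulrC.
    by rewrite eq_sym => ->; rewrite mul0r mulr0.
  apply: ler_sum => x _; apply: ler_sum => x' _.
  apply: ler_wpM2l; first exact: mulr_ge0.
  have [->|xx] := eqVneq x x'.
    rewrite (eq_bigr (a x')) ?sum_a ?mul1r ?lerDr// => y _.
    by rewrite /a -natrM mulnb andbb.
  rewrite mul0r addr0.
  have [/existsP[y /andP[xy x'y]]|] := boolP [exists y, incident x y && incident x' y].
    rewrite (bigD1 y) //= big1 ?addr0 => [|z zy].
      by rewrite /a xy x'y mulr1.
    rewrite /a -natrM mulnb; case: andP => // -[xz x'z].
    by rewrite (incident_inj xx xz x'z xy x'y) eqxx in zy.
  move=> /existsPn h; rewrite big1 // => y _.
  by rewrite /a -natrM mulnb (negPf (h y)).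
clearbody S.
have -> : \sum_y (q%:R * T y - S) ^+ 2 =
    q%:R ^+ 2 * (\sum_y T y ^+ 2) - 2 * q%:R * S * (\sum_y T y) + q%:R ^+ 2 * S ^+ 2.
  rewrite !mulr_sumr -sumrB.
  have -> : q%:R ^+ 2 * S ^+ 2 = \sum_(y : V) S ^+ 2.
    by rewrite sumr_const card_prod -[RHS]mulr_natl natrM expr2.
  by rewrite -big_split; apply: eq_bigr => y _ /=; ring.
rewrite sT.
have := ler_wpM2l (exprn_ge0 2 (ler0n int q)) sT2.
by move: (q%:R : int) (\sum_y T y ^+ 2) (\sum_x f x ^+ 2) => Q A B; lra.
Qed.

(** Each deviation [d] satisfies [l * |d| <= l ^ 2 + d ^ 2]; summing this against
    [g] reduces the claim to the second moment. *)
Lemma incident_mixing (g : V -> int) (K l : int) : 0 <= l -> (forall x, 0 <= g x <= K) ->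
  `| l * q%:R * (\sum_y g y * T y) - l * S * \sum_y g y | <=
   K * (l ^+ 2 * q%:R ^+ 2 + q%:R ^+ 3 * \sum_x f x ^+ 2).
Proof.
move=> l0 gK; move: second_moment; clearbody S => sm; set d := fun y => q%:R * T y - S.
have -> : l * q%:R * (\sum_y g y * T y) - l * S * \sum_y g y =
   \sum_y g y * (l * d y).
  rewrite !mulr_sumr -sumrB; apply: eq_bigr => y _; rewrite /d; ring.
apply: le_trans (ler_norm_sum _ _ _) _.
apply: (@le_trans _ _ (\sum_y K * (l ^+ 2 + d y ^+ 2))).
  apply: ler_sum => y _; have /andP[g0 gk] := gK y.
  rewrite normrM (ger0_norm g0); apply: ler_pM => //.
  rewrite ler_norml; have := sqr_ge0 (l - d y); have := sqr_ge0 (l + d y); nra.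
rewrite -mulr_sumr; apply: ler_wpM2l.
  by have /andP[/le_trans h /h] := gK (0, 0).
rewrite big_split /= sumr_const card_prod -[X in X + _]mulr_natr natrM -[_%:R * _]expr2.
by rewrite lerD.
Qed.
End SecondMoment.

Lemma host_mixing : mixing host_adj q.
Proof.
move=> f g K l gK err.
pose fz x : int := (f x)%:R; pose gz x : int := (g x)%:R.
pose E := (\sum_x \sum_(y | incident x y) f x * g y)%N.
have fz0 x : 0 <= fz x by rewrite ler0n.
have gzK x : 0 <= gz x <= K%:R by rewrite ler0n ler_nat gK.
have := incident_mixing fz0 (ler0n _ l) gzK.
have -> : \sum_y gz y * (\sum_x (incident x y)%:R * fz x) = E%:R.
  transitivity (\sum_y \sum_x gz y * ((incident x y)%:R * fz x)).
    by apply: eq_bigr => y _; rewrite mulr_sumr.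
  rewrite natr_sum exchange_big; apply: eq_bigr => x _ /=.
  rewrite natr_sum [RHS]big_mkcond; apply: eq_bigr => y _ /=.
  by rewrite /fz /gz; case: incident; rewrite ?mul0r ?mulr0 // mul1r natrM mulrC.
have -> : \sum_x fz x = (\sum_x f x)%:R by rewrite natr_sum.
have -> : \sum_x gz x = (\sum_x g x)%:R by rewrite natr_sum.
have -> : \sum_x fz x ^+ 2 = (\sum_x f x ^ 2)%:R.
  by rewrite natr_sum; apply: eq_bigr => x _; rewrite natrX.
have E1 : (edge_sum host_adj f g <= E)%N.
  apply: leq_sum => x _; rewrite big_mkcond [leqRHS]big_mkcond /=.
  by apply: leq_sum => y _; rewrite /host_adj; case: eqP; case: incident.
have E2 : (E <= edge_sum host_adj f g + \sum_x f x * g x)%N.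
  rewrite /edge_sum -big_split; apply: leq_sum => x _ /=.
  rewrite (bigID (host_adj x)) /= leq_add //.
    by apply: eq_leq; apply: eq_bigl => y; rewrite /host_adj andbC -andbA andbb.
  apply: leq_trans (_ : \sum_(y | y == x) f x * g y <= _)%N; last by rewrite big_pred1_eq.
  rewrite big_mkcond [leqRHS]big_mkcond /=; apply: leq_sum => y _.
  by rewrite /host_adj eq_sym; case: eqP; case: incident.
rewrite -!natrX -!natrM -natrD -natrM ler_norml => /andP[].
rewrite lerNl opprB !lerBlDr -!natrD !ler_nat => lo up; split.
  apply: leq_trans (leq_mul (leqnn _) E1) _; apply: leq_trans up _.
  by rewrite addnC.
apply: leq_trans lo _; rewrite addnC leq_add2r.
exact: leq_mul.
Qed.
End Host.

(** * The theorem *)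

Section HostGraph.
Variable F : finFieldType.

Definition host : sgraph := SGraph (@host_adj_sym F) (@host_adj_irr F).
Local Open Scope nat_scope.

Lemma card_host_edges : #|edges host| <= #|F| ^ 4.
Proof.
apply: leq_trans (_ : #|{: host * host}| <= _); last first.
  by rewrite !card_prod !expnS expn0 muln1 !mulnA.
apply: leq_trans (_ : #|[set [set p.1; p.2] | p : host * host]| <= _).
  apply/subset_leq_card/subsetP => e /imset2P[x y _ _ ->].
  by apply/imsetP; exists (x, y).
exact: leq_imset_card.
Qed.

(** A closed path found from layer [t.+1] gives a cycle of length
    [t.*2 + 7], and [t < 2 * l - 3] is what the bound [4 * l] on the length
    allows, with [l = up_log 2 k]. *)
Lemma host_induced_odd_cycle k (c : {set host} -> 'I_k) :
    3 <= k -> #|F| = (256 ^ k) ^ 12 ->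
  exists h (p : seq host), [/\ odd h, 5 <= h <= 4 * up_log 2 k,
    is_cycle p /\ size p = h, monochromatic c p & induced_cycle p].
Proof.
move=> k3 cF; apply: contrapT => none.
have lk : up_log 2 k <= k by apply: up_log_min => //; rewrite ltnW // ltn_expl.
have l2 : 2 <= up_log 2 k.
  by rewrite ltnNge; apply/negP => l1; have := @up_logP 2 k isT;
     rewrite leqNgt (leq_ltn_trans _ k3) // -[2]expn1 leq_exp2l.
have kK n : 256 * n.+1 <= 256 ^ n.+1.
  elim: n => // n ih; rewrite expnS; apply: leq_mul => //.
  by apply: leq_trans ih; lia.
apply: (@descent_absurd host k #|F| c (@host_mixing F) _ (up_log 2 k)
  (@host_C4free F) (@host_degree F) _ cF _ l2 lk (@up_logP 2 k isT)).
- exact: leq_trans k3.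
- exact: card_prod.
- by case: (k) k3.
move=> i H Hcol Hsym v p t tl sp cp; apply: none.
have [|cyc mono ind] := closed_induced_path Hcol Hsym _ cp; first by rewrite sp; lia.
exists (t.*2 + 7), (v :: p); split=> //.
- by rewrite oddD odd_double.
- by lia.
- by rewrite /= sp -addnS.
Qed.
End HostGraph.

Theorem theorem1p2 (R : realType) :
  exists C : R, 0 < C /\
    forall k : nat, (3 <= k)%N ->
      exists F : sgraph,
        (#|edges F|%:R <= expR (C * k%:R) :> R) /\
        forall c : {set F} -> 'I_k,
          exists (h : nat) (p : seq F),
            [/\ odd h, (5 <= h <= 4 * up_log 2 k)%N,
                is_cycle p /\ size p = h,
                monochromatic c p & induced_cycle p].
Proof.
(* 384 = 8 * 12 * 4: the field has (2 ^ (8 * k)) ^ 12 elements, and the host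
   graph has at most the fourth power of that number of edges. *)
have b1 : (1 : R) < 2 ^+ 384 by rewrite exprn_egt1 // ltr1n.
exists (ln (2 ^+ 384)); split; first exact: ln_gt0.
move=> k k3.
have m_gt0 : (0 < 96 * k)%N by rewrite muln_gt0 (leq_trans _ k3).
have [F _ cF] := pPrimePowerField (isT : prime 2) m_gt0.
have {}cF : #|F| = ((256 ^ k) ^ 12)%N.
  rewrite cF -expnM (_ : 256 = 2 ^ 8)%N // -expnM; congr (_ ^ _)%N; lia.
exists (host F); split; last by move=> c; exact: host_induced_odd_cycle.
rewrite expRM_natr lnK ?posrE ?(lt_trans ltr01) // -natrX -natrX ler_nat.
apply: leq_trans (card_host_edges F) _; rewrite cF.
rewrite (_ : 256 = 2 ^ 8)%N // -!expnM leq_exp2l //; lia.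
Qed.
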